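(* Let $(A,+,\circ,\sigma)$ be a two-sided truss and define a binary operation $\bullet$ on $A$ by $$a\bullet b = a\circ b - \sigma(a+b).$$ Then $(A,+,\bullet)$ is an (associative) ring. The assignment $(A,+,\circ,\sigma)\mapsto(A,+,\bullet)$ defines a functor, acting on morphisms as the identity, from the category of two-sided trusses to the category of rings.
   Context: A two-sided truss $(A,+,\circ,\sigma)$ consists of an abelian group $(A,+)$, an associative binary operation $\circ$ on $A$ and a function $\sigma: A\to A$ such that for all $a,b,c\in A$, $a\circ(b+c) = a\circ b + a\circ c - \sigma(a)$ and $(a+b)\circ c = a\circ c + b\circ c - \sigma(c)$ ($\circ$ takes precedence over $+$). A morphism of trusses is a function that is a homomorphism both of the groups (for $+$) and of the semigroups (for $\circ$). Rings are associative and not required to have a multiplicative identity; ring morphisms are maps preserving $+$ and the multiplication. *)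

(* Defs.v *)
From mathcomp Require Import all_boot all_algebra.
From mathcomp Require Import boolp.

Set Implicit Arguments.
Unset Strict Implicit.
Unset Printing Implicit Defensive.

Import GRing.Theory.
Local Open Scope ring_scope.

Record category := Category {
  obj :> Type;
  hom : obj -> obj -> Type;
  idc : forall a, hom a a;
  comp : forall a b c, hom b c -> hom a b -> hom a c;
  comp_idl : forall a b (f : hom a b), comp (idc b) f = f;
  comp_idr : forall a b (f : hom a b), comp f (idc a) = f;
  compA : forall a b c d (h : hom c d) (g : hom b c) (f : hom a b),
    comp h (comp g f) = comp (comp h g) f }.

Arguments idc {c} a : rename.
Arguments comp {_ _ _ _} g f : rename.

Definition is_functor (C D : category) (Fo : C -> D)
    (Fm : forall a b : C, hom a b -> hom (Fo a) (Fo b)) : Prop :=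
  (forall a : C, Fm a a (idc a) = idc (Fo a)) /\
  (forall (a b c : C) (g : hom b c) (f : hom a b),
     Fm a c (comp g f) = comp (Fm b c g) (Fm a b f)).

Record is_truss (A : zmodType) (circ : A -> A -> A) (sigma : A -> A) : Prop :=
  IsTruss {
    truss_assoc : associative circ;
    truss_distr_r : forall a b c : A,
      circ a (b + c) = circ a b + circ a c - sigma a;
    truss_distr_l : forall a b c : A,
      circ (a + b) c = circ a c + circ b c - sigma c }.

Record truss := Truss {
  truss_zmod :> zmodType;
  circ : truss_zmod -> truss_zmod -> truss_zmod;
  sigma : truss_zmod -> truss_zmod;
  trussP : is_truss circ sigma }.

Arguments circ {t} _ _.
Arguments sigma {t} _.

(* Compatibility with sigma is not required. *)
Record is_truss_hom (A B : truss) (f : A -> B) : Prop := IsTrussHom {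
  truss_homD : {morph f : x y / x + y};
  truss_homM : {morph f : x y / circ x y} }.

Record truss_hom (A B : truss) := TrussHom {
  truss_fun :> A -> B;
  truss_funP : is_truss_hom truss_fun }.

Lemma truss_hom_eq (A B : truss) (f g : truss_hom A B) :
  truss_fun f = truss_fun g -> f = g.
Proof.
case: f g => [f fP] [g gP] /= fg.
by case: _ / fg gP => gP; congr TrussHom; apply: Prop_irrelevance.
Qed.

Lemma is_truss_hom_id (A : truss) : is_truss_hom (fun x : A => x).
Proof. by split. Qed.

Lemma is_truss_hom_comp (A B C : truss) (g : truss_hom B C)
  (f : truss_hom A B) : is_truss_hom (fun x => g (f x)).
Proof.
by split=> x y; rewrite ?(truss_homD (truss_funP _)) ?(truss_homM (truss_funP _)).
Qed.

Definition truss_cat : category.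
Proof.
refine (@Category truss truss_hom
  (fun A => TrussHom (is_truss_hom_id A))
  (fun A B C g f => TrussHom (is_truss_hom_comp g f)) _ _ _);
  by move=> *; apply: truss_hom_eq.
Defined.

(* MathComp's ring structures all carry a unit; here none is assumed. *)
Record is_rng (A : zmodType) (mul : A -> A -> A) : Prop := IsRng {
  rng_assoc : associative mul;
  rng_distr_l : left_distributive mul +%R;
  rng_distr_r : right_distributive mul +%R }.

Record rng := Rng {
  rng_zmod :> zmodType;
  rng_mul : rng_zmod -> rng_zmod -> rng_zmod;
  rngP : is_rng rng_mul }.

Arguments rng_mul {r} _ _.

Record is_rng_hom (R S : rng) (f : R -> S) : Prop := IsRngHom {
  rng_homD : {morph f : x y / x + y};
  rng_homM : {morph f : x y / rng_mul x y} }.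

Record rng_hom (R S : rng) := RngHom {
  rng_fun :> R -> S;
  rng_funP : is_rng_hom rng_fun }.

Lemma rng_hom_eq (R S : rng) (f g : rng_hom R S) :
  rng_fun f = rng_fun g -> f = g.
Proof.
case: f g => [f fP] [g gP] /= fg.
by case: _ / fg gP => gP; congr RngHom; apply: Prop_irrelevance.
Qed.

Lemma is_rng_hom_id (R : rng) : is_rng_hom (fun x : R => x).
Proof. by split. Qed.

Lemma is_rng_hom_comp (R S T : rng) (g : rng_hom S T) (f : rng_hom R S) :
  is_rng_hom (fun x => g (f x)).
Proof.
by split=> x y; rewrite ?(rng_homD (rng_funP _)) ?(rng_homM (rng_funP _)).
Qed.

Definition rng_cat : category.
Proof.
refine (@Category rng rng_hom
  (fun R => RngHom (is_rng_hom_id R))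
  (fun R S T g f => RngHom (is_rng_hom_comp g f)) _ _ _);
  by move=> *; apply: rng_hom_eq.
Defined.

Definition bullet (A : truss) (a b : A) : A := circ a b - sigma (a + b).

(* Main.v *)
(** In a truss [sigma a = a o 0 = 0 o a], so [sigma] preserves every affine
    combination, and associativity of [o] gives
    [sigma (a o b) = a o sigma b = sigma a o b].  Expanding with these rules,
    both bracketings of [a . b . c] are equal to
    [a o b o c - sigma (a o b) - sigma (a o c) - sigma (b o c)] plus a symmetric
    affine expression in [sigma (sigma _)].  Morphisms preserve [0] and [o],
    hence [sigma], hence the new product. *)
Require Import Defs.
From mathcomp Require Import all_boot all_algebra.

Set Implicit Arguments.
Unset Strict Implicit.
Unset Printing Implicit Defensive.

Import GRing.Theory.
Local Open Scope ring_scope.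

Section Truss.

Variable A : truss.
Implicit Types a b c : A.

Lemma circA : associative (@circ A).
Proof. exact: truss_assoc (trussP A). Qed.

Lemma circDr a b c : circ a (b + c) = circ a b + circ a c - sigma a.
Proof. exact: truss_distr_r (trussP A) a b c. Qed.

Lemma circDl a b c : circ (a + b) c = circ a c + circ b c - sigma c.
Proof. exact: truss_distr_l (trussP A) a b c. Qed.

Lemma circ0r a : circ a 0 = sigma a.
Proof.
(* With [x = circ a 0] this reads [x = x + x - sigma a]; cancel one [x]. *)
have /eqP := circDr a 0 0.
by rewrite addr0 -addrA eq_sym -subr_eq0 addrAC subrr add0r subr_eq0 => /eqP.
Qed.

Lemma circ0l a : circ 0 a = sigma a.
Proof.
have /eqP := circDl 0 0 a.
by rewrite addr0 -addrA eq_sym -subr_eq0 addrAC subrr add0r subr_eq0 => /eqP.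
Qed.

Lemma circBr a b c : circ a (b - c) = circ a b - circ a c + sigma a.
Proof.
have := circDr a (b - c) c; rewrite subrK => ->.
by rewrite addrAC subrK addrK.
Qed.

Lemma circBl a b c : circ (a - b) c = circ a c - circ b c + sigma c.
Proof.
have := circDl (a - b) b c; rewrite subrK => ->.
by rewrite addrAC subrK addrK.
Qed.

(** Since [sigma] is multiplication by [0], this is distributivity with right factor [0]. *)
Lemma sigmaD a b : sigma (a + b) = sigma a + sigma b - sigma (0 : A).
Proof. by rewrite -!circ0r circDl !circ0r. Qed.

Lemma sigmaB a b : sigma (a - b) = sigma a - sigma b + sigma (0 : A).
Proof. by rewrite -!circ0r circBl !circ0r. Qed.

(** The coefficients sum to 1, so the [sigma 0] corrections cancel. *)
Lemma sigmaBD a b c : sigma (a - b + c) = sigma a - sigma b + sigma c.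
Proof. by rewrite sigmaD sigmaB addrAC addrK. Qed.

Lemma sigmaDB a b c : sigma (a + b - c) = sigma a + sigma b - sigma c.
Proof. by rewrite addrAC sigmaBD addrAC. Qed.

(** Associativity with last factor [0]. *)
Lemma circ_sigmar a b : circ a (sigma b) = sigma (circ a b).
Proof. by rewrite -!circ0r circA. Qed.

Lemma circ_sigmal a b : circ (sigma a) b = sigma (circ a b).
Proof. by rewrite -!circ0l circA. Qed.

Lemma sigma_sigmaD a b :
  sigma (sigma (a + b)) =
    sigma (sigma a) + sigma (sigma b) - sigma (sigma (0 : A)).
Proof. by rewrite sigmaD sigmaDB. Qed.

Lemma bulletA : associative (@bullet A).
Proof.
move=> a b c; rewrite /bullet.
have -> : a + (circ b c - sigma (b + c)) = circ b c - sigma (b + c) + a.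
  by rewrite addrC.
rewrite circBr circBl !sigmaBD circ_sigmar circ_sigmal circDr circDl.
rewrite !sigmaDB !sigma_sigmaD circA.
(* Here [t] is [sigma a] on the left and [sigma c] on the right: the correction from [circBr] or
   [circBl] cancels the last term of [sigmaBD]. *)
have cancelr (x y z t : A) : x + t - (y + z + t) = x - y - z.
  by rewrite opprD addrACA subrr addr0 opprD addrA.
rewrite !cancelr !opprB !addrA.
(* Both sides end in [- sigma (sigma 0)]; the other seven terms agree up to order. *)
by congr (_ - _); rewrite !opprD !addrA [LHS](ACl (1*7*4*5*3*2*6)).
Qed.

Lemma bulletDl : left_distributive (@bullet A) +%R.
Proof.
move=> a b c; rewrite /bullet circDl.
(* This affine form makes [sigma] split into the terms of the two products, and its [sigma c]
   cancels the one from [circDl]. *)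
have -> : a + b + c = a + c + (b + c) - c by rewrite addrA addrK addrAC.
by rewrite sigmaDB opprB addrA subrK opprD addrACA.
Qed.

Lemma bulletDr : right_distributive (@bullet A) +%R.
Proof.
move=> a b c; rewrite /bullet circDr.
have -> : a + (b + c) = a + b + (a + c) - a.
  by rewrite [a + c]addrC !addrA addrK.
by rewrite sigmaDB opprB addrA subrK opprD addrACA.
Qed.

End Truss.

Section Morphism.

Variables (A B : truss) (f : truss_hom A B).

Lemma truss_hom0 : f 0 = 0.
Proof.
by apply: (addrI (f 0)); rewrite -(truss_homD (truss_funP f)) !addr0.
Qed.

Lemma truss_homN a : f (- a) = - f a.
Proof.
by apply: (addrI (f a)); rewrite -(truss_homD (truss_funP f)) !subrr truss_hom0.
Qed.

Lemma truss_hom_sigma a : f (sigma a) = sigma (f a).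
Proof. by rewrite -!circ0r (truss_homM (truss_funP f)) truss_hom0. Qed.

Lemma truss_hom_bullet : {morph f : a b / bullet a b}.
Proof.
move=> a b; rewrite /bullet (truss_homD (truss_funP f)) truss_homN.
by rewrite (truss_homM (truss_funP f)) truss_hom_sigma (truss_homD (truss_funP f)).
Qed.

End Morphism.

Theorem theorem5p2 :
  exists (bulletP : forall A : truss, is_rng (@bullet A))
         (homP : forall (A B : truss) (f : truss_hom A B),
            @is_rng_hom (Rng (bulletP A)) (Rng (bulletP B)) (truss_fun f)),
    @is_functor truss_cat rng_cat
      (fun A : truss => Rng (bulletP A))
      (fun (A B : truss) (f : truss_hom A B) => RngHom (homP A B f)).
Proof.
exists (fun A => IsRng (@bulletA A) (@bulletDl A) (@bulletDr A)).
unshelve eexists.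
  move=> A B f; split; first exact: truss_homD (truss_funP f).
  exact: truss_hom_bullet.
(* Both functor laws compare morphisms with the same underlying function. *)
by split=> *; apply: rng_hom_eq.
Qed.
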